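(* Let $q\ge 11$ be a prime power, let $n=m(2,q)$ (that is, $n=q+2$ if $q$ is even and $n=q+1$ if $q$ is odd), and let $\mathcal{C}\leqslant\mathbb{F}_q^n$ be an $[n,3,n-2]_q$ MDS code. Let $\mathbf{G}\in\mathbb{F}_q^{3\times n}$ be a generator matrix of $\mathcal{C}$ such that 1) $\min\{|R| : R\in\mathcal{R}_i(\mathbf{G})\text{ for some }i\in\{1,2,3\}\}=2$, and 2) for every $i\in\{1,2,3\}$, $\{R\in\mathcal{R}_i(\mathbf{G}) : |R|=2\}$ is a partition of $[n]=\{1,\dots,n\}$. Let $\mathbf{S}\in\mathbb{F}_q^{3\times n}$ be a systematic generator matrix of $\mathcal{C}$. Then $\Lambda(\mathbf{G})\supsetneq\Lambda(\mathbf{S})$, i.e. the service rate region of $\mathbf{G}$ strictly contains that of $\mathbf{S}$.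
   Context: An $[n,k,d]_q$ code is a $k$-dimensional linear subspace of $\mathbb{F}_q^n$ with minimum Hamming distance $d$; it is MDS if $d+k=n+1$. A $k\times n$ generator matrix is systematic if each standard basis vector $\mathbf{e}_1,\dots,\mathbf{e}_k$ of $\mathbb{F}_q^k$ occurs among its columns. For $\mathbf{G}=(\mathbf{g}_1\mid\dots\mid\mathbf{g}_n)\in\mathbb{F}_q^{k\times n}$ with columns $\mathbf{g}_j$, and $i\in[k]$, a recovery set for the $i$-th object is a set $J\subseteq[n]$ such that $\mathbf{e}_i\in\langle\mathbf{g}_j : j\in J\rangle$. A recovery set for the $i$-th object is minimal if it does not properly contain another recovery set for the $i$-th object. $\mathcal{R}_i(\mathbf{G})$ denotes the collection of minimal recovery sets for the $i$-th object. A vector $(\lambda_1,\dots,\lambda_k)\in\mathbb{R}^k$ is supported by $\mathbf{G}$ if there is a feasible allocation for it, i.e. real numbers $\{\lambda_{i,R} : i\in[k],\ R\in\mathcal{R}_i(\mathbf{G})\}$ with $\lambda_{i,R}\ge 0$ for all $i,R$; $\sum_{R\in\mathcal{R}_i(\mathbf{G})}\lambda_{i,R}=\lambda_i$ for all $i\in[k]$; and $\sum_{i=1}^k\sum_{R\in\mathcal{R}_i(\mathbf{G}),\, j\in R}\lambda_{i,R}\le 1$ for all $j\in[n]$. The service rate region $\Lambda(\mathbf{G})\subseteq\mathbb{R}^k$ is the set of all vectors supported by $\mathbf{G}$. *)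

(* Defs.v *)
From HB Require Import structures.
From mathcomp Require Import all_boot all_order all_algebra.
From mathcomp Require Import classical_sets reals.

Set Implicit Arguments.
Unset Strict Implicit.
Unset Printing Implicit Defensive.

Import Order.TTheory GRing.Theory Num.Theory.
Local Open Scope ring_scope.

(* [m] is the minimum of [P]; in particular [P] is nonempty. *)
Definition is_minimum (P : nat -> Prop) (m : nat) : Prop :=
  P m /\ forall m' : nat, P m' -> (m <= m')%N.

Section Codes.
Variables (F : finFieldType) (n : nat).

Definition hamming_dist (x y : 'rV[F]_n) : nat :=
  #|[set j : 'I_n | x 0 j != y 0 j]|.

Definition min_distance (C : {vspace 'rV[F]_n}) (d : nat) : Prop :=
  is_minimum
    (fun m => exists x y : 'rV[F]_n,
       [/\ x \in C, y \in C, x != y & hamming_dist x y = m]) d.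

Definition linear_code (C : {vspace 'rV[F]_n}) (k d : nat) : Prop :=
  \dim C = k /\ min_distance C d.

Definition mds_code (C : {vspace 'rV[F]_n}) (k d : nat) : Prop :=
  linear_code C k d /\ (d + k = n + 1)%N.

Definition generator_mx (C : {vspace 'rV[F]_n}) (k : nat) (G : 'M[F]_(k, n)) :
    Prop :=
  basis_of C [seq row i G | i : 'I_k].

Variable k : nat.

(* [delta_mx i 0] is the [i]-th standard basis (column) vector. *)
Definition std_basis (i : 'I_k) : 'cV[F]_k := delta_mx i 0.

Definition systematic (G : 'M[F]_(k, n)) : Prop :=
  forall i : 'I_k, exists j : 'I_n, col j G = std_basis i.

Definition recovery_set (G : 'M[F]_(k, n)) (i : 'I_k) (J : {set 'I_n}) : bool :=
  std_basis i \in <<[seq col j G | j in J]>>%VS.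

Definition min_recovery_sets (G : 'M[F]_(k, n)) (i : 'I_k) : {set {set 'I_n}} :=
  [set J | minset (recovery_set G i) J].

(* The values of [lam i] outside [min_recovery_sets G i] are irrelevant. *)
Definition feasible_allocation (R : realType) (G : 'M[F]_(k, n))
    (l : 'rV[R]_k) (lam : 'I_k -> {set 'I_n} -> R) : Prop :=
  [/\ forall i J, J \in min_recovery_sets G i -> 0 <= lam i J,
      forall i, \sum_(J in min_recovery_sets G i) lam i J = l 0 i
    & forall j : 'I_n,
        \sum_(i < k) \sum_(J in min_recovery_sets G i | j \in J) lam i J <= 1].

Definition service_rate_region (R : realType) (G : 'M[F]_(k, n)) :
    set 'rV[R]_k :=
  [set l | exists lam, feasible_allocation G l lam]%classic.

End Codes.

Arguments service_rate_region {F n k} R G.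

(* The maximal size of an arc in PG(2, q), for [q] a prime power. *)
Definition m2 (q : nat) : nat := if odd q then (q + 1)%N else (q + 2)%N.

(* Main.v *)
(* Every point of [n] lies on exactly one pair of each of the three partitions,
   so spreading the demand for an object evenly over its pairs shows that
   Lambda(G) contains all l >= 0 with 2 (l_1 + l_2 + l_3) <= n.
   In S, the MDS property forces every recovery set of the i-th object that
   avoids the systematic column e_i to have size at least 3.  That column serves
   at most min(l_i, 1) of the demand, so adding up the n capacities gives
   sum_i (3 l_i - 2 min(l_i, 1)) <= n on Lambda(S).  Hence
   l_1 + l_2 + l_3 <= n/3 + 2 there, which is at most n/2 since n >= 12, and
   (n/2, 0, 0) violates the bound. *)
Require Import Defs.
From HB Require Import structures.
From mathcomp Require Import all_boot all_order all_algebra.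
From mathcomp Require Import classical_sets reals.
From mathcomp Require Import zify lra.

Set Implicit Arguments.
Unset Strict Implicit.
Unset Printing Implicit Defensive.

Import Order.TTheory GRing.Theory Num.Theory.
Local Open Scope ring_scope.

Lemma generator_mx_codeword (F : finFieldType) (n k : nat)
    (C : {vspace 'rV[F]_n}) (G : 'M[F]_(k, n)) (v : 'rV[F]_k) :
  generator_mx C G -> v *m G \in C.
Proof.
move=> hG; rewrite mulmx_sum_row; apply: memv_suml => i _; apply: memvZ.
by apply: (basis_mem hG); apply: map_f; rewrite mem_enum.
Qed.

Lemma generator_mx_inj (F : finFieldType) (n k : nat)
    (C : {vspace 'rV[F]_n}) (G : 'M[F]_(k, n)) (v : 'rV[F]_k) :
  generator_mx C G -> v *m G = 0 -> v = 0.
Proof.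
move=> /basis_free hG vG0.
have /freeP fG : free [tuple row i G | i < k] by [].
apply/rowP => i; rewrite mxE; apply: (fG (fun i => v 0 i)).
rewrite -[RHS]vG0 mulmx_sum_row; apply: eq_bigr => j _.
by rewrite -tnth_nth tnth_mktuple.
Qed.

Lemma card_zeros_codeword (F : finFieldType) (n d : nat)
    (C : {vspace 'rV[F]_n}) (c : 'rV[F]_n) :
  min_distance C d -> c \in C -> c != 0 ->
  (#|[set j | c 0%R j == 0%R]| + d <= n)%N.
Proof.
move=> [_ dmin] cC c0; rewrite -[leqRHS]card_ord -(cardC [set j | c 0 j == 0]).
rewrite leq_add2l; apply: leq_trans (dmin (hamming_dist c 0) _) _.
  by exists c, 0; split=> //; rewrite mem0v.
apply/subset_leq_card/fintype.subsetP => j.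
by rewrite !inE mxE.
Qed.

(** Fewer than [k] columns have rank below [k], so the submatrix they form has a nonzero left
    kernel. *)
Lemma exists_row_killing_cols (F : fieldType) (n k : nat) (G : 'M[F]_(k, n))
    (J : {set 'I_n}) :
  (#|J| < k)%N ->
  exists2 v : 'rV[F]_k, v != 0 & forall j, j \in J -> v *m col j G = 0.
Proof.
move=> Jk; pose A : 'M[F]_(k, #|J|) := colsub (@enum_val _ (mem J)) G.
exists (nz_row (kermx A)).
  rewrite nz_row_eq0 -mxrank_eq0 mxrank_ker subn_eq0 -ltnNge.
  exact: leq_ltn_trans (rank_leq_col A) Jk.
move=> j jJ; have /sub_kermxP vA := nz_row_sub (kermx A).
rewrite (_ : col j G = col (enum_rank_in jJ j) A).
  by rewrite colE mulmxA vA mul0mx.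
by apply/colP => i; rewrite !mxE enum_rankK_in.
Qed.

Lemma recovery_set_annihilator (F : finFieldType) (n k : nat)
    (G : 'M[F]_(k, n)) (i : 'I_k) (J : {set 'I_n}) (v : 'rV[F]_k) :
  recovery_set G i J -> (forall j, j \in J -> v *m col j G = 0) ->
  v *m std_basis F i = 0.
Proof.
move=> iJ vJ; have : std_basis F i \in lker (linfun (mulmx v : 'cV_k -> 'cV_1)).
  move: iJ; apply/subvP/span_subvP => _ /fintype.imageP[j jJ ->].
  by rewrite memv_ker lfunE /= vJ.
by rewrite memv_ker lfunE => /eqP.
Qed.

Lemma recovery_setS (F : finFieldType) (n k : nat) (G : 'M[F]_(k, n))
    (i : 'I_k) (J K : {set 'I_n}) :
  J \subset K -> recovery_set G i J -> recovery_set G i K.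
Proof.
move=> /fintype.subsetP sJK; apply/subvP/sub_span => _ /fintype.imageP[j jJ ->].
exact/fintype.image_f/sJK.
Qed.

(** If [#|J| = k - 1], some nonzero [v] kills the columns of [J], hence also the vector [e_i] in
    their span, which is column [j]. The nonzero codeword [v *m S] then has at least [k] zeros, one
    more than the [n - d] that the minimum distance allows. Smaller [J] are first enlarged. *)
Lemma mds_systematic_recovery_card (F : finFieldType) (n k d : nat)
    (C : {vspace 'rV[F]_n}) (S : 'M[F]_(k, n)) (i : 'I_k) (j : 'I_n)
    (J : {set 'I_n}) :
  mds_code C k d -> generator_mx C S -> col j S = std_basis F i ->
  recovery_set S i J -> j \notin J -> (k <= #|J|)%N.
Proof.
move=> [[dimC dC] dk] hS Sj.
have kn : (k <= n)%N.
  by rewrite -dimC (leq_trans (dimvS (subvf C)))// dimvf /dim /= mul1n.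
(* Induction on the gap [k - #|J|]: while [#|J| + 1 < k <= n], there is an index outside [j |: J] to
   add, and recovery sets are closed under enlargement. *)
have [m] := ubnP (k - #|J|); elim: m J => // m IHm J mJ iJ jJ.
rewrite leqNgt; apply/negP => Jk.
have [Jk'|Jk'] := ltnP #|J|.+1 k.
  have /fintype.subsetPn[x _ xJ] : ~~ ([set: 'I_n] \subset j |: J).
    apply/negP => /subset_leq_card; rewrite cardsT card_ord cardsU1 jJ; lia.
  move: xJ; rewrite finset.in_setU1 negb_or => /andP[xj xJ].
  have := IHm (x |: J).
  rewrite cardsU1 xJ finset.in_setU1 negb_or eq_sym xj jJ /=.
  have mJ' : (k - (1 + #|J|) < m)%N by lia.
  move=> /(_ mJ' (recovery_setS (finset.subsetUr _ _) iJ) isT).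
  by rewrite add1n leqNgt Jk'.
have [v v0 vJ] := exists_row_killing_cols S Jk.
have vSe l : v *m col l S = 0 -> (v *m S) 0 l == 0.
  by rewrite colE mulmxA -colE => /colP/(_ 0); rewrite !mxE => ->.
have := card_zeros_codeword dC (generator_mx_codeword v hS).
move=> /(_ (contra_neq (generator_mx_inj hS) v0)).
apply/negP; rewrite -ltnNge -addn1 -dk addnC leq_add2r.
apply: leq_trans Jk' _.
have -> : #|J|.+1 = #|j |: J| by rewrite cardsU1 jJ.
apply/subset_leq_card/fintype.subsetP => l; rewrite !inE => /orP[/eqP->|lJ].
  by apply: vSe; rewrite Sj (recovery_set_annihilator iJ).
exact/vSe/vJ.
Qed.

(** Serving object [i] through [J] uses [#|J|] units of capacity per unit of demand: at least 1 if
    [J] contains the systematic index [s], at least [k] otherwise. With [a] the demand served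
    through [s], object [i] uses at least [a + k * (l_i - a)]. *)
Lemma mds_systematic_region_le (R : realType) (F : finFieldType) (n k d : nat)
    (C : {vspace 'rV[F]_n}) (S : 'M[F]_(k, n)) (l : 'rV[R]_k) :
  mds_code C k d -> generator_mx C S -> systematic S ->
  service_rate_region R S l ->
  \sum_i (k%:R * l 0 i - k.-1%:R * Num.min (l 0 i) 1) <= n%:R.
Proof.
move=> hC hS Ssys [lam [lam0 laml lam1]].
have cap : \sum_(j < n) \sum_(i < k)
    \sum_(J in min_recovery_sets S i | j \in J) lam i J <= n%:R.
  rewrite -[n in n%:R]card_ord -sum1_card natr_sum.
  by apply: ler_sum => j _; exact: lam1.
apply: le_trans cap; rewrite exchange_big /=; apply: ler_sum => i _.
have [s Ss] := Ssys i.
pose a := \sum_(J in min_recovery_sets S i | s \in J) lam i J.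
have load (j : 'I_n) (i' : 'I_k) :
    0 <= \sum_(J in min_recovery_sets S i' | j \in J) lam i' J.
  by apply: sumr_ge0 => J /andP[/lam0].
(* [a] is part of the demand for [i] and part of the load on server [s]. *)
have a_le : a <= Num.min (l 0 i) 1.
  rewrite le_min; apply/andP; split.
    rewrite -laml /a [leRHS](bigID (fun J : {set _} => s \in J)) /= lerDl.
    by apply: sumr_ge0 => J /andP[/lam0].
  apply: le_trans (lam1 s); rewrite [leRHS](bigD1 i) //= lerDl.
  by apply: sumr_ge0 => i' _; exact: load.
apply: (@le_trans _ _ (k%:R * l 0 i - k.-1%:R * a)).
  by rewrite lerD2l lerN2 ler_wpM2l.
(* Double counting: summed over all servers, each [lam i J] occurs [#|J|] times, so the comparison
   can be made for each [J] separately. *)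
under eq_bigr do rewrite big_mkcondr.
rewrite exchange_big /= -laml /a big_mkcondr !mulr_sumr -sumrB.
apply: ler_sum => J Ji; rewrite -big_mkcond sumr_const -[leRHS]mulr_natl.
have lJ := lam0 _ _ Ji.
have [sJ|sJ] := boolP (s \in J).
  rewrite -mulrBl ler_wpM2r // -natrB ?leq_pred // ler_nat.
  have J0 : (0 < #|J|)%N by apply/card_gt0P; exists s.
  by apply: leq_trans J0; lia.
rewrite mulr0 subr0 ler_wpM2r // ler_nat.
apply: mds_systematic_recovery_card hC hS Ss _ sJ.
by move: Ji; rewrite inE => /minsetP[].
Qed.

(** Each of the [n / r] blocks for object [i] receives [r / n * l_i]. A server lies in exactly one
    block per object, so its load is [r / n] times the total demand. *)
Lemma uniform_partition_region (R : realType) (F : finFieldType) (n k r : nat)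
    (G : 'M[F]_(k, n)) (l : 'rV[R]_k) :
  (0 < n)%N ->
  (forall i : 'I_k, finset.partition
     [set J in min_recovery_sets G i | #|J| == r] [set: 'I_n]) ->
  (forall i, 0 <= l 0 i) -> r%:R * \sum_i l 0 i <= n%:R ->
  service_rate_region R G l.
Proof.
move=> n0 hG l0 ln; have n0R : 0 < n%:R :> R by rewrite ltr0n.
pose P i := [set J in min_recovery_sets G i | #|J| == r].
exists (fun i (J : {set _}) => if #|J| == r then r%:R / n%:R * l 0 i else 0).
split.
- by move=> i J _; case: ifP => // _; rewrite mulr_ge0 // divr_ge0.
- move=> i; rewrite -big_mkcondr /= (eq_bigl (mem (P i))); last first.
    by move=> J; rewrite !inE.
  rewrite sumr_const.
  have : #|[set: 'I_n]| = (#|P i| * r)%N.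
    by apply: card_uniform_partition (hG i) => J; rewrite inE => /andP[_ /eqP].
  rewrite cardsT card_ord => nE; rewrite -[LHS]mulr_natl !mulrA -natrM -nE.
  by rewrite divff ?mul1r // gt_eqF.
- move=> j; suff E i : \sum_(J in min_recovery_sets G i | j \in J)
      (if #|J| == r then r%:R / n%:R * l 0 i else 0) = r%:R / n%:R * l 0 i.
    under eq_bigr do rewrite E.
    by rewrite -mulr_sumr mulrAC ler_pdivrMr // mul1r.
  have /and3P[/eqP covP tiP _] := hG i.
  have jP : j \in finset.cover (P i) by rewrite covP inE.
  rewrite -big_mkcondr /= (big_pred1 (finset.pblock (P i) j)) // => J.
  rewrite andbAC; apply/andP/eqP => [[JP jJ]|->].
    by rewrite (finset.def_pblock tiP _ jJ) // inE.
  by rewrite finset.mem_pblock jP; have := finset.pblock_mem jP; rewrite inE.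
Qed.

Theorem proposition15 (R : realType) (F : finFieldType) (q n : nat)
    (hF : #|F| = q) (hq : (11 <= q)%N) (hn : n = m2 q)
    (C : {vspace 'rV[F]_n}) (hC : mds_code C 3 (n - 2))
    (G : 'M[F]_(3, n)) (hG : generator_mx C G)
    (hG1 : is_minimum
       (fun m => exists (i : 'I_3) (J : {set 'I_n}),
          J \in min_recovery_sets G i /\ #|J| = m) 2)
    (hG2 : forall i : 'I_3,
       finset.partition [set J in min_recovery_sets G i | #|J| == 2%N] [set: 'I_n])
    (S : 'M[F]_(3, n)) (hS : generator_mx C S) (hSsys : systematic S) :
  (service_rate_region R S `<` service_rate_region R G)%classic.
Proof.
(* Exactly what [n / 3 + 2 <= n / 2] requires; it is attained at [q = 11]. *)
have n12 : (12 <= n)%N by rewrite hn /m2; case: ifP; lia.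
have n12R : 12 <= n%:R :> R by rewrite ler_nat.
have boundS l := mds_systematic_region_le (l := l) hC hS hSsys.
have n0 : (0 < n)%N by lia.
split=> [l lS|/(_ (\row_i if i == 0 then n%:R / 2 else 0))].
  apply: (uniform_partition_region n0 hG2).
    case: lS => lam [lam0 laml _] i; rewrite -laml; apply: sumr_ge0 => J.
    exact: lam0.
  have := boundS R l lS; rewrite !big_ord_recl !big_ord0 /=.
  have min1 i : Num.min (l 0 i) 1 <= 1 by rewrite ge_min lexx orbT.
  move: (min1 ord0) (min1 (lift ord0 ord0)) (min1 (lift ord0 (lift ord0 ord0))).
  lra.
have inG : service_rate_region R G (\row_i if i == 0 then n%:R / 2 else 0).
  apply: (uniform_partition_region n0 hG2) => [i|].
    by rewrite mxE; case: ifP => // _; lra.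
  by rewrite !big_ord_recl big_ord0 !mxE /=; lra.
(* The minima are 1, 0 and 0, so the bound reads [3 * n / 2 - 2 <= n], forcing [n <= 4]. *)
move=> /(_ inG)/boundS; rewrite !big_ord_recl big_ord0 !mxE /=.
by rewrite (min_l ler01) min_r; lra.
Qed.
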